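(* For any cardinals $\lambda\ge\kappa\ge\omega$ and any natural number $d$, we have $\chi_{\rm CF}(\lambda,\kappa,d)\le\omega$, and in fact $[\lambda,\kappa,d]\Rightarrow\omega$.
   Context: For a function $f$ and set $A$, $I_f(A)=\{\xi\in\operatorname{ran}(f):|A\cap f^{-1}\{\xi\}|=1\}$. A $(\lambda,\kappa,\mu)$-system is a family $\mathcal A$ with $|\mathcal A|=\lambda$, $|A|=\kappa$ for all $A\in\mathcal A$, and $|A\cap A'|<\mu$ for distinct $A,A'\in\mathcal A$. A conflict free coloring of $\mathcal A$ with $\rho$ colors is $f:\bigcup\mathcal A\to\rho$ with $I_f(A)\neq\emptyset$ for all $A\in\mathcal A$; $\chi_{\rm CF}(\mathcal A)$ is the least such $\rho$, and $\chi_{\rm CF}(\lambda,\kappa,\mu)$ is its supremum over all $(\lambda,\kappa,\mu)$-systems. For $\lambda\ge\kappa\ge\rho\ge\omega$ and $\mu\le\kappa$, $[\lambda,\kappa,\mu]\Rightarrow\rho$ means: every $(\lambda,\kappa,\mu)$-system $\mathcal A$ admits $f:\bigcup\mathcal A\to\rho$ with $|\rho\setminus I_f(A)|<\rho$ for all $A\in\mathcal A$. *)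

(* Defs.v *)
From mathcomp Require Import all_boot.
From mathcomp Require Import boolp classical_sets cardinality.
Set Implicit Arguments. Unset Strict Implicit. Unset Printing Implicit Defensive.
Local Open Scope classical_set_scope.
Local Open Scope card_scope.

(* Cardinals are represented by types: a cardinal lambda is the cardinality
   of [set: L] for a type L. *)

Definition I_f (T R : Type) (f : T -> R) (A : set T) : set R :=
  [set xi | range f xi /\ (A `&` f @^-1` [set xi]) #= `I_1].

Definition system (T L K : Type) (d : nat) (Fam : set (set T)) : Prop :=
  [/\ Fam #= [set: L],
      (forall A, Fam A -> A #= [set: K]) &
      (forall A B, Fam A -> Fam B -> A <> B ->
         exists n, (n < d)%N /\ (A `&` B) #= `I_n)].

Definition cf_colorable_omega (T : Type) (Fam : set (set T)) : Prop :=
  exists f : T -> nat, forall A, Fam A -> I_f f A !=set0.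

Definition arrow_omega (L K : Type) (d : nat) : Prop :=
  forall (T : Type) (Fam : set (set T)), system L K d Fam ->
    exists f : T -> nat, forall A, Fam A -> finite_set (~` I_f f A).

(* Main.v *)
Require Import Defs.
From mathcomp Require Import all_boot.
From mathcomp Require Import boolp classical_sets functions cardinality wochoice.
Set Implicit Arguments. Unset Strict Implicit. Unset Printing Implicit Defensive.
Local Open Scope classical_set_scope.
Local Open Scope card_scope.

(* If lambda <= kappa, well-order the pairs (A, n) so that proper initial
   segments have size < kappa, and pick x(A, n) in A recursively: a new point,
   outside every other B that already contains d + 1 earlier points.  There are
   fewer than kappa such B, and each meets A in at most d points, so this is
   possible.  Colour x(A, n) with n + 1 and everything else with 0: apart from
   the x(A, n), the set A contains only finitely many chosen points.

   If lambda > kappa, well-order the family and let C(a) be the closure of the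
   initial segment up to a under adding every set with d + 1 points in the union
   of the sets already present.  C(a) is no larger than max(kappa, |a|), so by
   induction the block of sets entering at stage a has a good colouring.  A set
   of that block meets the union of all earlier stages in at most d points, so
   each point may be coloured by the first block covering it. *)

(** * Comparing cardinalities by injections *)

Lemma card_le_fun T U (A : set T) (B : set U) (f : A -> U) :
  injective f -> (forall a, B (f a)) -> A #<= B.
Proof.
move=> finj fB.
rewrite -(card_le_eql (card_setT A)).
have fi : {in [set: A] &, injective f} by move=> x y _ _; exact: finj.
rewrite -(card_le_eql (inj_card_eq fi)).
by apply: subset_card_le => _ [a _ <-]; exact: fB.
Qed.

Lemma card_leE T U (A : set T) (B : set U) :
  A #<= B -> exists2 f : A -> U, injective f & forall a, B (f a).
Proof.
move=> /card_leP[f]; exists (fun a => val (f a)).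
  by move=> x y /val_inj; apply: inj; rewrite inE.
by move=> a; exact: set_valP.
Qed.

Lemma card_leTE T U (B : set U) :
  [set: T] #<= B -> exists2 f : T -> U, injective f & forall x, B (f x).
Proof.
move=> /card_leE[f finj fB].
have mT (x : T) : x \in [set: T] by rewrite inE.
exists (fun x => f (SigSub (mT x))) => // x y /finj /(congr1 val).
exact.
Qed.

(** Choice extracts the injection, so later proofs can describe it by a relation on plain points and
    avoid membership proofs. *)
Lemma card_le_rel T U (A : set T) (B : set U) (R : T -> U -> Prop) :
  (forall a, A a -> exists2 b, B b & R a b) ->
  (forall a a' b, A a -> A a' -> R a b -> R a' b -> a = a') -> A #<= B.
Proof.
move=> RAB Rinj.
have /choice[f fP] : forall a : A, exists b, B b /\ R (val a) b.
  by move=> a; have [b ? ?] := RAB _ (set_valP a); exists b.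
apply: (@card_le_fun _ _ _ _ f) => [a a' ff|a]; last by case: (fP a).
apply/val_inj; apply: (Rinj _ _ (f a)); [exact: set_valP..| |].
  by case: (fP a).
by rewrite ff; case: (fP a').
Qed.

(** Zorn gives a maximal partial injection. It is defined on all of [A] or hits all of [B], since
    otherwise a pair of unmatched points could be added. *)
Lemma card_le_total T U (A : set T) (B : set U) : A #<= B \/ B #<= A.
Proof.
pose P (G : set (T * U)) := [/\ G `<=` A `*` B,
  (forall a b b', G (a, b) -> G (a, b') -> b = b') &
  (forall a a' b, G (a, b) -> G (a', b) -> a = a')].
have [|G [[GAB Gfun Ginj] Gmax]] := @Zorn_bigcup _ P.
  move=> F FP Ftot; split.
  - by move=> p [G /FP[GAB _ _] Gp]; exact: GAB.
  - move=> a b b' [G FG Gab] [G' FG' Gab'].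
    have [GG'|GG'] := Ftot _ _ FG FG'.
      by have [_ + _] := FP _ FG'; apply; [exact: (GG' _ Gab)|exact: Gab'].
    by have [_ + _] := FP _ FG; apply; [exact: Gab|exact: (GG' _ Gab')].
  - move=> a b b' [G FG Gab] [G' FG' Gab'].
    have [GG'|GG'] := Ftot _ _ FG FG'.
      by have [_ _] := FP _ FG'; apply; [exact: (GG' _ Gab)|exact: Gab'].
    by have [_ _] := FP _ FG; apply; [exact: Gab|exact: (GG' _ Gab')].
have [domA|] := pselect (forall a, A a -> exists b, G (a, b)).
  left; apply: (@card_le_rel _ _ _ _ (fun a b => G (a, b))).
    by move=> a /domA[b Gab]; exists b => //; case: (GAB _ Gab).
  by move=> a a' b _ _; exact: Ginj.
move=> /existsNP[a /not_implyP[Aa /forallNP Ga]].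
have [ranB|] := pselect (forall b, B b -> exists a, G (a, b)).
  right; apply: (@card_le_rel _ _ _ _ (fun b a => G (a, b))).
    by move=> b /ranB[a' Gab]; exists a' => //; case: (GAB _ Gab).
  by move=> b b' a' _ _; exact: Gfun.
move=> /existsNP[b /not_implyP[Bb /forallNP Gb]].
exfalso; apply: (Gmax (G `|` [set (a, b)])); last split.
- split; first exact: subsetUl.
  by move=> /(_ (a, b)) GU; apply: (Ga b); apply: GU; right.
- by move=> p [/GAB//|->].
- move=> a1 b1 b2 [G1|e1] [G2|e2]; first exact: Gfun G1 G2.
  + by case: e2 => e2 _; case: (Ga b1); rewrite -e2.
  + by case: e1 => e1 _; case: (Ga b2); rewrite -e1.
  + by case: e1 => _ ->; case: e2 => _ ->.
- move=> a1 a2 b1 [G1|e1] [G2|e2]; first exact: Ginj G1 G2.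
  + by case: e2 => _ e2; case: (Gb a1); rewrite -e2.
  + by case: e1 => _ e1; case: (Gb a2); rewrite -e1.
  + by case: e1 => -> _; case: e2 => -> _.
Qed.

Lemma card_le_setX T T' U U' (A : set T) (A' : set T') (B : set U) (B' : set U') :
  A #<= B -> A' #<= B' -> A `*` A' #<= B `*` B'.
Proof.
move=> /card_leE[f fi fB] /card_leE[g gi gB].
apply: (@card_le_rel _ _ _ _ (fun p q => exists (a : A) (a' : A'),
  p = (val a, val a') /\ q = (f a, g a'))).
  move=> [x y] [/= /mem_set Ax /mem_set Ay].
  exists (f (SigSub Ax), g (SigSub Ay)).
    by split; [exact: fB|exact: gB].
  by exists (SigSub Ax), (SigSub Ay).
by move=> p p' q _ _ [a [a' [-> ->]]] [b [b' [-> [/fi <- /gi <-]]]].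
Qed.

(** Two distinct points [c0], [c1] of [C] serve as tags for the two parts of the union. *)
Lemma card_le_setU_setX T (A B : set T) U (C : set U) :
  infinite_set C -> A #<= C -> B #<= C -> A `|` B #<= C `*` C.
Proof.
move=> /infiniteP/card_leE[c ci cC] /card_leE[f fi fB] /card_leE[g gi gB].
have ct n : [set: nat] n by [].
pose c0 := c (SigSub (mem_set (ct 0))); pose c1 := c (SigSub (mem_set (ct 1))).
have c01 : c0 <> c1 by move=> /ci /(congr1 val).
apply: (@card_le_rel _ _ _ _ (fun x q =>
  (exists a : A, x = val a /\ q = (f a, c0)) \/
  (exists b : B, x = val b /\ q = (g b, c1)))).
  move=> x [/mem_set Ax|/mem_set Bx].
    exists (f (SigSub Ax), c0); first by split=> //=; exact: cC.
    by left; exists (SigSub Ax).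
  exists (g (SigSub Bx), c1); first by split=> //=; exact: cC.
  by right; exists (SigSub Bx).
move=> x x' q _ _ [[a [-> ->]]|[a [-> ->]]] [[b [-> e]]|[b [-> e]]].
- by case: e => /fi ->.
- by case: e => _ /c01.
- by case: e => _ /esym /c01.
- by case: e => /gi ->.
Qed.

(** * Squares of infinite cardinals *)

Definition diag_dom T (G : set (T * T * T)) := [set x | exists c, G (x, x, c)].

(* [G] is the graph of an injection from [D `*` D] to [D] for some [D]; then
   necessarily [D = diag_dom G], which makes [D] monotone along chains. *)
Definition pairing_graph T (G : set (T * T * T)) :=
  [/\ (forall p c c', G (p, c) -> G (p, c') -> c = c'),
      (forall p p' c, G (p, c) -> G (p', c) -> p = p'),
      (forall x y c, G (x, y, c) -> [/\ diag_dom G x, diag_dom G y & diag_dom G c]) &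
      (forall x y, diag_dom G x -> diag_dom G y -> exists c, G (x, y, c))].

Lemma pairing_graph_card T (G : set (T * T * T)) :
  pairing_graph G -> diag_dom G `*` diag_dom G #<= diag_dom G.
Proof.
move=> [Gfun Ginj Gdom Gtot].
apply: (@card_le_rel _ _ _ _ (fun p c => G (p, c))).
  move=> [x y] [/= Gx Gy]; have [c Gc] := Gtot _ _ Gx Gy.
  by exists c => //; case: (Gdom _ _ _ Gc).
by move=> p p' c _ _; exact: Ginj.
Qed.

Lemma pairing_graph_nat T (h : nat -> T) : injective h ->
  exists2 G : set (T * T * T), pairing_graph G & infinite_set (diag_dom G).
Proof.
move=> hinj.
pose G : set (T * T * T) :=
  [set t | exists i j, t = (h i, h j, h (pickle (i, j)))].
have domG x : diag_dom G x <-> exists i, x = h i.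
  split=> [[c [i [j [-> _ _]]]]|[i ->]]; first by exists i.
  by exists (h (pickle (i, i))), i, i.
exists G; first split.
- by move=> p c c' [i [j [-> ->]]] [i' [j' [/hinj <- /hinj <- ->]]].
- move=> p p' c [i [j [-> ->]]] [i' [j' [-> /hinj]]].
  by move=> /(pcan_inj pickleK) [-> ->].
- by move=> x y c [i [j [-> -> ->]]]; split; apply/domG; eexists.
- move=> x y /domG[i ->] /domG[j ->].
  by exists (h (pickle (i, j))), i, j.
apply/infiniteP; apply: (@card_le_rel _ _ _ _ (fun n x => x = h n)).
  by move=> n _; exists (h n) => //; apply/domG; exists n.
by move=> n m x _ _ -> /hinj.
Qed.

(** Take a maximal pairing graph, with domain [D]. If the complement of [D] embeds in [D], two
    copies of [D] cover [T] and the claim follows. Otherwise the complement contains a copy [E] of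
    [D], and the new pairs over the union can be coded in [E], against maximality. *)
Lemma card_setX_infinite T : infinite_set [set: T] -> [set: T * T] #<= [set: T].
Proof.
move=> Tinf.
have [h hinj _] : exists2 h : nat -> T, injective h & forall n, [set: T] (h n).
  by apply: card_leTE; exact/infiniteP.
have [G0 G0P G0inf] := pairing_graph_nat hinj.
(* The alternative [G = set0] admits the union of the empty chain. *)
pose P (G : set (T * T * T)) := pairing_graph G /\ (infinite_set (diag_dom G) \/ G = set0).
have subdom (G G' : set (T * T * T)) : G `<=` G' -> diag_dom G `<=` diag_dom G'.
  by move=> GG' x [c Gc]; exists c; exact: GG'.
have [|G [[GP Ginf] Gmax]] := @Zorn_bigcup _ P.
  move=> F FP Ftot.
  have bigdom X x : F X -> diag_dom X x -> diag_dom (\bigcup_(Y in F) Y) x.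
    by move=> FX; apply: subdom; exact: bigcup_sup.
  split; first split.
  - move=> p c c' [X FX Xp] [Y FY Yp].
    have [XY|XY] := Ftot _ _ FX FY.
      by have [[+ _ _ _] _] := FP _ FY; apply; [exact: (XY _ Xp)|exact: Yp].
    by have [[+ _ _ _] _] := FP _ FX; apply; [exact: Xp|exact: (XY _ Yp)].
  - move=> p c c' [X FX Xp] [Y FY Yp].
    have [XY|XY] := Ftot _ _ FX FY.
      by have [[_ + _ _] _] := FP _ FY; apply; [exact: (XY _ Xp)|exact: Yp].
    by have [[_ + _ _] _] := FP _ FX; apply; [exact: Xp|exact: (XY _ Yp)].
  - move=> x y c [X FX Xc]; have [[_ _ Xdom _] _] := FP _ FX.
    by have [? ? ?] := Xdom _ _ _ Xc; split; exact: bigdom FX _.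
  - move=> x y [c [X FX Xc]] [c' [Y FY Yc]].
    have [XY|XY] := Ftot _ _ FX FY.
      have [[_ _ _ Ytot] _] := FP _ FY.
      by have [||z Yz] := Ytot x y; [exists c; exact: XY|exists c'|exists z, Y].
    have [[_ _ _ Xtot] _] := FP _ FX.
    by have [||z Xz] := Xtot x y; [exists c|exists c'; exact: XY|exists z, X].
  have [[X [FX Xinf]]|noinf] := pselect (exists X, F X /\ infinite_set (diag_dom X)).
    left; apply: sub_infinite_set Xinf; apply: subdom; exact: bigcup_sup.
  right; rewrite -subset0 => t [X FX Xt].
  have [_ [Xinf|X0]] := FP _ FX; first by case: noinf; exists X.
  by rewrite X0 in Xt.
have {}Ginf : infinite_set (diag_dom G).
  case: Ginf => // G_0; exfalso; apply: (Gmax G0); last by split=> //; left.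
  rewrite G_0; split=> [t []|G00]; apply: G0inf.
  rewrite subset0 in G00; rewrite G00.
  have -> : diag_dom (@set0 (T * T * T)) = set0 by rewrite -subset0 => x [].
  exact: finite_set0.
set D := diag_dom G in Ginf.
have DD : D `*` D #<= D by exact: pairing_graph_card.
have [cD|cD] := card_le_total (~` D) D.
  have TD : [set: T] #<= D.
    rewrite -(setUv D); apply: card_le_trans DD.
    by apply: card_le_setU_setX => //; exact: card_lexx.
  have -> : [set: T * T] = [set: T] `*` [set: T] by apply/seteqP; split.
  apply: card_le_trans (card_leT D); apply: card_le_trans DD.
  exact: card_le_setX.
have [e einj eD] := card_leE cD.
pose E := range e.
have ED : E #<= D.
  by apply: card_le_trans (card_image_le _ _) _; rewrite (card_le_eql (card_setT D)); exact: card_lexx.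
pose DE := D `|` E.
have DED : DE #<= D.
  by apply: card_le_trans DD; apply: card_le_setU_setX => //; exact: card_lexx.
have : DE `*` DE #<= D by apply: card_le_trans DD; exact: card_le_setX.
move=> /card_leE[phi phiinj phiD].
(* [phi] codes pairs in [D], and [e] moves the code into [E]. The new values are therefore disjoint
   from those of [G]. *)
pose psi (p : set_type (DE `*` DE)) : T := e (SigSub (mem_set (phiD p))).
have psiinj : injective psi by move=> p q /einj /(congr1 val) /phiinj.
have psiE p : E (psi p) by exists (SigSub (mem_set (phiD p))).
have EnD x : E x -> ~ D x by move=> [a _ <-]; exact: eD.
case: (GP) => Gfun Ginj Gdom Gtot.
pose H : set (T * T * T) := [set t | exists p : set_type (DE `*` DE),
  t = (val p, psi p) /\ ~ (D `*` D) (val p)].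
have mDE (x y : T) : DE x -> DE y -> (x, y) \in DE `*` DE.
  by move=> Dx Dy; apply/mem_set; split.
have domGH x : diag_dom (G `|` H) x <-> DE x.
  split.
    move=> [c [Gx|[[[y z] p] [[/= -> _ _] _]]]]; first by left; exists c.
    by move/set_mem: p => [].
  have [Dx|nDx DEx] := pselect (D x).
    by case: Dx => c ? _; exists c; left.
  exists (psi (SigSub (mDE _ _ DEx DEx))); right.
  by exists (SigSub (mDE _ _ DEx DEx)); split => //= -[].
have GDD p c : G (p, c) -> (D `*` D) p /\ D c by case: p => x y /Gdom[].
exfalso; apply: (Gmax (G `|` H)).
  split=> [|GHG]; first exact: subsetUl.
  have [x Dx] := infinite_setN0 Ginf.
  have : diag_dom (G `|` H) (e (SigSub (mem_set Dx))).
    by apply/domGH; right; eexists.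
  by move=> /(subdom _ _ GHG) /EnD; apply; exists (SigSub (mem_set Dx)).
split; last by left; apply: sub_infinite_set Ginf; exact/subdom/subsetUl.
split.
- move=> p c c' [G1|[q [[-> ->] nq]]] [G2|[q' [[e1 ->] nq']]].
  + exact: Gfun G1 G2.
  + by rewrite e1 in G1; case: nq'; case: (GDD _ _ G1).
  + by case: nq; case: (GDD _ _ G2).
  + by congr psi; exact/val_inj.
- move=> p p' c [G1|[q [[-> ->] nq]]] [G2|[q' [[-> e1] nq']]].
  + exact: Ginj G1 G2.
  + by case: (EnD c); [rewrite e1|case: (GDD _ _ G1)].
  + by case: (EnD (psi q)); last by case: (GDD _ _ G2).
  + by congr val; exact: psiinj.
- move=> x y c [/Gdom[? ? ?]|[[[x' y'] p] [[/= -> -> ->] _]]].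
    by split; apply/domGH; left.
  move/set_mem: (p) => [/= ? ?].
  by split; apply/domGH => //; right; exact: psiE.
- move=> x y /domGH Dx /domGH Dy.
  have [[? ?]|nD] := pselect ((D `*` D) (x, y)).
    by have [c Gc] := Gtot x y ltac:(assumption) ltac:(assumption); exists c; left.
  exists (psi (SigSub (mDE _ _ Dx Dy))); right.
  by exists (SigSub (mDE _ _ Dx Dy)).
Qed.

Lemma card_setX_le T (J : set T) : infinite_set J -> J `*` J #<= J.
Proof.
move=> Jinf.
have JT : infinite_set [set: J].
  by apply: contra_not Jinf; rewrite (eq_finite_set (card_setT J)).
rewrite -(card_le_eqr (card_setT J)); apply: card_le_trans (card_setX_infinite JT).
have -> : [set: J * J] = [set: J] `*` [set: J] by apply/seteqP; split.
by apply: card_le_setX; rewrite (card_le_eqr (card_setT J)); exact: card_lexx.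
Qed.

(** * Sets of bounded size *)

(* |X| <= |J| up to finite sets: stable under finite operations also for finite J. *)
Definition small TJ T (J : set TJ) (X : set T) := finite_set X \/ X #<= J.

Lemma small_finite TJ T (J : set TJ) (X : set T) :
  finite_set J -> small J X -> finite_set X.
Proof. by move=> Jfin [//|/card_le_finite]; apply. Qed.

Lemma small_infinite TJ T (J : set TJ) (X : set T) :
  infinite_set J -> small J X -> X #<= J.
Proof.
by move=> /infiniteP Jinf [/finite_set_countable|//]; move/card_le_trans; apply.
Qed.

Lemma small_le TJ T U (J : set TJ) (X : set T) (Y : set U) :
  Y #<= X -> small J X -> small J Y.
Proof.
by move=> YX [/(card_le_finite YX)|/(card_le_trans YX)]; [left|right].
Qed.

(** For infinite [J], a point is coded by an index and its place in that member, and [J] absorbs its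
    square. For finite [J] everything is finite. *)
Lemma small_bigcup TJ T I (J : set TJ) (D : set I) (F : I -> set T) :
  small J D -> (forall i, D i -> small J (F i)) -> small J (\bigcup_(i in D) F i).
Proof.
have [Jfin|Jinf] := pselect (finite_set J).
  move=> /(small_finite Jfin) Dfin Ffin; left; apply: bigcup_finite => //.
  by move=> i /Ffin /(small_finite Jfin).
move=> /(small_infinite Jinf) /card_leE[g ginj gJ] FJ.
have h (i : D) : {h : F (val i) -> TJ | injective h /\ forall x, J (h x)}.
  apply: cid; have /(small_infinite Jinf) := FJ _ (set_valP i).
  by move=> /card_leE[h ? ?]; exists h.
right; apply: card_le_trans (card_setX_le Jinf).
apply: (@card_le_rel _ _ _ _ (fun x p => exists (i : D) (y : F (val i)),
  x = val y /\ p = (g i, sval (h i) y))).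
  move=> x [i /mem_set Di /mem_set Fx].
  pose i' : D := SigSub Di; pose y : F (val i') := SigSub (Fx : x \in F (val i')).
  exists (g i', sval (h i') y); last by exists i', y.
  by have [_ hJ] := svalP (h i'); split; [exact: gJ|exact: hJ].
move=> x x' p _ _ [i [y [-> ->]]] [i' [y' [-> []]]] /ginj ii'.
by move: ii' y' => <- y'; case: (svalP (h i)) => /[swap] _ /[apply] ->.
Qed.

Lemma small_setU TJ T (J : set TJ) (X Y : set T) :
  small J X -> small J Y -> small J (X `|` Y).
Proof.
move=> sX sY.
have -> : X `|` Y = \bigcup_(b in [set: bool]) (if b then X else Y).
  apply/seteqP; split=> [x [Xx|Yx]|x [[] _ ?]]; first by exists true.
  - by exists false.
  - by left.
  - by right.
apply: small_bigcup => [|[]//].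
by left; exact: finite_finset.
Qed.

Lemma small_setX TJ T U (J : set TJ) (X : set T) (Y : set U) :
  small J X -> small J Y -> small J (X `*` Y).
Proof.
move=> sX sY.
have -> : X `*` Y = \bigcup_(x in X) (pair x @` Y).
  apply/seteqP; split=> [[x y] [/= Xx Yy]|_ [x Xx [y Yy <-]]//].
  by exists x => //; exists y.
apply: small_bigcup => // x _; apply: small_le sY; exact: card_image_le.
Qed.

Lemma small_seqs TJ T (J : set TJ) (X : set T) n : small J X ->
  small J [set s | exists2 h, s = mkseq h n & forall k, (k < n)%N -> X (h k)].
Proof.
move=> sX; elim: n => [|n IHn].
  by left; apply: (sub_finite_set _ (finite_set1 [::])) => s [h ->].
apply: small_le (small_setX IHn sX).
apply: (@card_le_rel _ _ _ _ (fun s p => s = rcons p.1 p.2)).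
  move=> s [h -> hX]; exists (mkseq h n, h n); last by rewrite mkseqS.
  by split=> /=; [exists h => // k kn; apply: hX; exact: leqW|exact: hX].
by move=> s s' p _ _ -> ->.
Qed.

(** * Well-orders and recursive choice *)

Definition wellorder T (lt : T -> T -> Prop) :=
  [/\ well_founded lt, (forall x y z, lt x y -> lt y z -> lt x z) &
      (forall x y, [\/ lt x y, x = y | lt y x])].

Lemma wellorder_min T (lt : T -> T -> Prop) (P : set T) x : wellorder lt ->
  P x -> exists2 x, P x & forall y, lt y x -> ~ P y.
Proof.
move=> [wf _ _] Px; apply: contrapT => /forall2NP nP.
elim/(well_founded_ind wf): x Px => {}x IH Px.
by have [|] := nP x; [apply|apply=> y /IH].
Qed.

Lemma wellorder_exists (T : Type) : exists lt : T -> T -> Prop, wellorder lt.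
Proof.
elim/Peq : T => T; have [R Rwo] := well_ordering_principle T.
have RwoT : @wo_chain T R predT by move=> A _; exact: Rwo.
have Rtot x y : R x y || R y x by exact: (wo_chainW RwoT).
have Ranti x y : R x y -> R y x -> x = y.
  move=> xy yx; apply: (wo_chain_antisymmetric RwoT) => //.
  by rewrite xy yx.
exists (fun x y => ~ R y x); split.
- move=> x; apply: contrapT => nx.
  have [|z [[/asboolP zA zmin] _]] := Rwo [pred x | `[< ~ Acc (fun x y : T => ~ R y x) x >]].
    by exists x; apply/asboolP.
  apply: zA; split => y nzy; apply: contrapT => ny; apply: nzy.
  by apply: zmin; apply/asboolP.
- move=> x y z nyx nzy zx.
  (* The least of [x], [y], [z] is [R]-below the other two, which refutes the cycle in each case. *)
  have [u [[uA umin] _]] := Rwo [pred u | `[< u = x \/ u = y \/ u = z >]]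
    ltac:(by exists x; apply/asboolP; left).
  have ux : R u x by apply: umin; apply/asboolP; left.
  have uy : R u y by apply: umin; apply/asboolP; right; left.
  have uz : R u z by apply: umin; apply/asboolP; right; right.
  move/asboolP : uA => [e|[e|e]]; subst u => //.
  by apply: nzy; rewrite (Ranti _ _ zx uz).
- move=> x y; have [xy|nxy] := pselect (R x y); last by apply: Or33.
  have [yx|nyx] := pselect (R y x); last by apply: Or31.
  by apply: Or32; exact: Ranti.
Qed.

Lemma wellorder_pullback T U (lt : U -> U -> Prop) (f : T -> U) :
  injective f -> wellorder lt -> wellorder (fun x y => lt (f x) (f y)).
Proof.
move=> finj [wf tr tri]; split.
- move=> x; move: {2}(f x) (erefl (f x)) => u; elim/(well_founded_ind wf): u x.
  by move=> u IH x e; split=> y; rewrite e => /IH; apply.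
- by move=> x y z; exact: tr.
- by move=> x y; have [?|/finj|?] := tri (f x) (f y); [apply: Or31|apply: Or32|apply: Or33].
Qed.

Lemma card_init_pullback T U (lt : U -> U -> Prop) (f : T -> U) x :
  injective f -> [set y | lt (f y) (f x)] #<= [set u | lt u (f x)].
Proof.
move=> finj; apply: (@card_le_rel _ _ _ _ (fun y u => u = f y)) => /=.
  by move=> y yx; exists (f y).
by move=> y y' u _ _ -> /finj.
Qed.

(** If some segment is as large as [T], take the first such and pull the order back along an
    injection of [T] into it. A full-sized segment of the new order would yield an earlier one in
    the old. *)
Lemma initial_wellorder_exists (T : Type) : exists lt : T -> T -> Prop,
  wellorder lt /\ forall x, ~ ([set: T] #<= [set y | lt y x]).
Proof.
have [lt ltwo] := wellorder_exists T.
have [H|] := pselect (forall x, ~ ([set: T] #<= [set y | lt y x])).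
  by exists lt.
move=> /existsNP[x0 /contrapT x0P].
have [x xP xmin] := wellorder_min (P := [set x | [set: T] #<= [set y | lt y x]])
  ltwo x0P.
have [f finj fx] := card_leTE xP.
exists (fun y z => lt (f y) (f z)); split; first exact: wellorder_pullback.
move=> y yP; apply: (xmin (f y)); first exact: fx.
by rewrite /=; apply: card_le_trans yP _; exact: card_init_pullback.
Qed.

(** Well-founded recursion for a choice that depends on earlier values only. [P] reads a total
    function, so [cut] pads it with [t0]; locality of [P] makes the padding harmless. *)
Lemma wf_choice I T (t0 : T) (lt : I -> I -> Prop) (P : I -> (I -> T) -> T -> Prop) :
  well_founded lt ->
  (forall i x x' t, (forall j, lt j i -> x j = x' j) -> P i x t -> P i x' t) ->
  (forall i x, exists t, P i x t) -> exists x, forall i, P i x (x i).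
Proof.
move=> wf Pext Pex.
have /choice[c cP] : forall ix : I * (I -> T), exists t, P ix.1 ix.2 t.
  by move=> [i x]; exact: Pex.
pose cut i (rec : forall j, lt j i -> T) j :=
  if pselect (lt j i) is left ji then rec j ji else t0.
pose F i rec := c (i, @cut i rec).
pose x := Fix wf (fun=> T) F.
have xE i : x i = F i (fun j _ => x j).
  apply: Fix_eq => k f g fg; rewrite /F; congr (c (k, _)).
  by apply/funext => j; rewrite /cut; case: pselect => // ji; exact: fg.
exists x => i; rewrite xE; apply: Pext (cP (i, _)) => j ji /=.
by rewrite /cut; case: pselect.
Qed.

(** * Finite thresholds *)

Lemma card_II_le T (Y : set T) n (h : nat -> T) :
  (forall k, (k < n)%N -> Y (h k)) ->
  (forall k l, (k < n)%N -> (l < n)%N -> h k = h l -> k = l) -> `I_n #<= Y.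
Proof.
move=> hY hinj; apply: (@card_le_rel _ _ _ _ (fun k y => y = h k)) => /=.
  by move=> k /hY; exists (h k).
by move=> k l y kn ln -> /hinj; apply.
Qed.

Lemma card_II_leE T (Y : set T) n : `I_n.+1 #<= Y ->
  exists2 h : nat -> T, forall k, (k < n.+1)%N -> Y (h k) &
    forall k l, (k < n.+1)%N -> (l < n.+1)%N -> h k = h l -> k = l.
Proof.
move=> /card_leE[h0 h0inj h0Y].
(* Clamping at [n] makes the enumeration total on [nat]. *)
have mI k : minn k n \in `I_n.+1 by rewrite inE /= ltnS geq_minr.
exists (fun k => h0 (SigSub (mI k))) => [k _ //|k l kn ln /h0inj /(congr1 val) /=].
by rewrite !(minn_idPl _).
Qed.

Lemma not_card_II_finite T (Y : set T) n : ~ (`I_n #<= Y) -> finite_set Y.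
Proof.
move=> nY; apply: contrapT => /infiniteP Yinf; apply: nY.
by apply: card_le_trans Yinf; exact: card_leT.
Qed.

(** Finitely many points of a directed union lie in one member. The positive threshold supplies a
    first point, hence a first index. *)
Lemma card_II_bigcup T I (D : set I) (F : I -> set T) (Y : set T) n :
  (forall i j, D i -> D j -> exists2 k, D k & F i `|` F j `<=` F k) ->
  `I_n.+1 #<= Y `&` \bigcup_(i in D) F i ->
  exists2 i, D i & `I_n.+1 #<= Y `&` F i.
Proof.
move=> Fdir /card_II_leE[h hY hinj].
suff [i Di Fi] : exists2 i, D i & forall k, (k < n.+1)%N -> F i (h k).
  exists i => //; apply: (card_II_le (h := h)) => // k kn; split; last exact: Fi.
  by case: (hY k kn).
suff H m : (m < n.+1)%N -> exists2 i, D i & forall k, (k < m.+1)%N -> F i (h k).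
  exact: H.
elim: m => [|m IHm] mn.
  have [_ [i Di Fi]] := hY 0 mn.
  by exists i => // k; rewrite ltnS leqn0 => /eqP ->.
have [i Di Fi] := IHm (ltnW mn); have [_ [j Dj Fj]] := hY _ mn.
have [k Dk Fk] := Fdir _ _ Di Dj; exists k => // l.
rewrite ltnS leq_eqVlt => /predU1P[->|lm]; apply: Fk; first by right.
by left; exact: Fi.
Qed.

(** Among [n + 1] distinct points of [Z], the largest has the other [n] below it; [bump k]
    enumerates those others. *)
Lemma wellorder_infinite T (lt : T -> T -> Prop) (Z : set T) n :
  wellorder lt -> infinite_set Z ->
  exists2 z, Z z & `I_n #<= Z `&` [set y | lt y z].
Proof.
move=> [_ tr tri] /infiniteP /card_leTE[h hinj hZ].
suff H m : exists2 k, (k < m.+1)%N & forall j, (j < m.+1)%N -> j <> k -> lt (h j) (h k).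
  have [k kn hk] := H n; exists (h k) => //.
  apply: (card_II_le (h := fun j => h (bump k j))) => [j jn|i j _ _ /hinj /(can_inj (bumpK k)) //].
  split=> //=; apply: hk; last by apply/eqP; rewrite eq_sym neq_bump.
  by rewrite /bump; case: (k <= j)%N; rewrite ?add1n ?add0n ltnS // ltnW.
elim: m => [|m [k km hk]].
  by exists 0 => // j; rewrite ltnS leqn0 => /eqP ->.
have [km1|e|km1] := tri (h k) (h m.+1).
- exists m.+1 => // j; rewrite ltnS leq_eqVlt => /predU1P[->//|jm] _.
  have [->//|/eqP jk] := eqVneq j k.
  by apply: tr km1; exact: hk.
- by move: km; rewrite (hinj _ _ e) ltnn.
- exists k; first exact: ltnW.
  by move=> j; rewrite ltnS leq_eqVlt => /predU1P[->//|jm] /hk; apply.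
Qed.

(** * Sparse families and uniquely attained colours *)

(* In a system with pairwise intersections of size < d no two sets share d + 1
   points; using d + 1 keeps the threshold positive when d = 0. *)
Definition sparse Lam T d (A : Lam -> set T) :=
  forall i j, i <> j -> ~ (`I_d.+1 #<= A i `&` A j).

(** A tuple of [d + 1] distinct points of [X] lies in at most one member, so the indices inject into
    the tuples over [X]. *)
Lemma sparse_few Lam T d (A : Lam -> set T) TJ (J : set TJ) (X : set T) :
  sparse d A -> small J X -> small J [set i | `I_d.+1 #<= A i `&` X].
Proof.
move=> Asp /(small_seqs d.+1); apply: small_le.
apply: (@card_le_rel _ _ _ _ (fun i s => exists h, [/\ s = mkseq h d.+1,
   (forall k, (k < d.+1)%N -> A i (h k)) &
   (forall k l, (k < d.+1)%N -> (l < d.+1)%N -> h k = h l -> k = l)])).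
  move=> i /card_II_leE[h hA hinj]; exists (mkseq h d.+1).
    by exists h => // k /hA[].
  by exists h; split=> // k /hA[].
move=> i j s _ _ [h [-> hA hinj]] [h' [hh' hA' _]]; apply: contrapT => /Asp; apply.
apply: (card_II_le (h := h)) => // k kd; split; first exact: hA.
have -> : h k = h' k by rewrite -(nth_mkseq (h 0) h kd) hh' nth_mkseq.
exact: hA'.
Qed.

Lemma I_fE T R (f : T -> R) A c : I_f f A c <-> (A `&` f @^-1` [set c]) #= `I_1.
Proof.
split=> [[]//|cA]; split=> //.
have [[t [_ <-]]|e] := pselect (exists t, (A `&` f @^-1` [set c]) t).
  by exists t.
have : A `&` f @^-1` [set c] = set0.
  by rewrite -subset0 => t At; apply: e; exists t.
move=> e0; move: cA; rewrite e0 card_eq_sym card_eq0 => /eqP.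
by move=> /(congr1 (@^~ 0)) /=; rewrite propeqE => -[/(_ isT)].
Qed.

(** Only colours that [f] or [g] takes on [W] can lose or gain uniqueness. *)
Lemma cofinite_I_f_modify T R (f g : T -> R) (A W : set T) :
  finite_set W -> (forall t, A t -> ~ W t -> f t = g t) ->
  cofinite_set (I_f f A) -> cofinite_set (I_f g A).
Proof.
move=> Wfin fg fA.
apply: (@sub_finite_set _ _ (~` I_f f A `|` (f @` W `|` g @` W))); last first.
  by rewrite !finite_setU; split=> //; split; exact: finite_image.
move=> c; apply: contra_notP => /not_orP[/contrapT /I_fE cA /not_orP[cf cg]].
apply/I_fE; rewrite -(card_eql (_ : (A `&` f @^-1` [set c]) #= _)) //.
suff -> : A `&` f @^-1` [set c] = A `&` g @^-1` [set c] by exact: card_eqxx.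
apply/seteqP; split=> t [At /= tc]; split=> //=; rewrite -tc.
  by apply/esym/fg => // Wt; apply: cf; exists t.
by apply: fg => // Wt; apply: cg; exists t.
Qed.

(** * Families of at most kappa sets *)

Lemma cf_coloring_base Lam T K d (A : Lam -> set T) :
  infinite_set [set: K] -> [set: Lam] #<= [set: K] -> sparse d A ->
  (forall i, [set: K] #<= A i) ->
  exists f : T -> nat, forall i, cofinite_set (I_f f (A i)).
Proof.
move=> Kinf LK Asp KA.
have [[b0 _]|nL] := pselect (exists b : Lam, True); last first.
  by exists (fun=> 0) => i; case: nL; exists i.
have [t0 _] : A b0 !=set0.
  by apply: infinite_setN0 => /(card_le_finite (KA b0)).
have IK : [set: Lam * nat] #<= [set: K].
  have -> : [set: Lam * nat] = [set: Lam] `*` [set: nat] by apply/seteqP; split.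
  apply: card_le_trans (card_setX_le Kinf); apply: card_le_setX => //.
  exact/infiniteP.
(* Pulling back an initial well-order of [K] leaves fewer than kappa pairs before each pair. *)
have [lt [ltwo ltK]] : exists lt : Lam * nat -> Lam * nat -> Prop, wellorder lt /\
    forall i, ~ ([set: K] #<= [set j | lt j i]).
  have [r rinj _] := card_leTE IK.
  have [lt [ltwo ltK]] := initial_wellorder_exists K.
  exists (fun i j => lt (r i) (r j)); split; first exact: wellorder_pullback.
  move=> i /card_le_trans /(_ (card_init_pullback lt i rinj)); exact: ltK.
pose P i (x : Lam * nat -> T) t := [/\ A i.1 t, (forall j, lt j i -> x j <> t) &
  (forall b, b <> i.1 -> `I_d.+1 #<= A b `&` x @` [set j | lt j i] -> ~ A b t)].
have [||x xP] := @wf_choice _ _ t0 lt P ltac:(by case: ltwo).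
- move=> i x x' t xx' [At tx tb]; split=> // [j ji|b bi].
    by rewrite -xx' //; exact: tx.
  suff -> : x' @` [set j | lt j i] = x @` [set j | lt j i] by exact: tb.
  by apply/seteqP; split=> _ [j ji <-]; exists j => //; rewrite xx'.
- move=> i x; apply: contrapT => /forallNP nP.
  pose J := [set j | lt j i].
  pose B := [set b | `I_d.+1 #<= A b `&` x @` J] `\ i.1.
  have sx : small J (x @` J) by right; exact: card_image_le.
  (* If no point is admissible, [A i.1] is covered by the earlier points and its finite traces on
     the sets in [B]. It would then be too small to have size at least kappa. *)
  have sA : small J (A i.1).
    apply: (@small_le _ _ _ _ (x @` J `|` \bigcup_(b in B) (A i.1 `&` A b))).
      apply: subset_card_le => t At; apply: contrapT => /not_orP[tx tb].
      apply: (nP t); split=> // [j ji xj|b bi bx Abt].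
        by apply: tx; exists j.
      by apply: tb; exists b => //; split.
    apply: small_setU => //; apply: small_bigcup.
      apply: small_le (sparse_few Asp sx); apply: subset_card_le.
      exact: subIsetl.
    move=> b [_ /nesym bi]; left; apply: not_card_II_finite; exact: Asp bi.
  have [/Kinf|/ltK] := small_le (KA i.1) sA; exact.
have xinj : injective x.
  move=> i j ij; have [_ _ /(_ i j)[ltij|//|ltji]] := ltwo.
    by have [_ /(_ _ ltij) + _] := xP j; rewrite ij.
  by have [_ /(_ _ ltji) + _] := xP i; rewrite ij.
pose f t := if pselect (exists i, x i = t) is left e then (projT1 (cid e)).2.+1 else 0.
have fx i : f (x i) = i.2.+1.
  rewrite /f; case: pselect => [e|[]]; last by exists i.
  by case: cid => j /= /xinj ->.
have fS t n : f t = n.+1 -> exists b, x (b, n) = t.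
  rewrite /f; case: pselect => // e; case: cid => -[b m] /= <- [->].
  by exists b.
exists f => b.
pose Z := [set j | j.1 <> b /\ A b (x j)].
(* Otherwise some [z] in [Z] has [d + 1] predecessors in [Z]. They give [d + 1] earlier chosen
   points of [A b], so [x z] had to avoid [A b]. *)
have Zfin : finite_set Z.
  apply: contrapT => /(wellorder_infinite d.+1 ltwo)[z [zb Abz]] dz.
  have [_ _ /(_ b (nesym zb))] := xP z; apply => //.
  have [h hZ hinj] := card_II_leE dz.
  apply: (card_II_le (h := x \o h)) => [k kd|k l kd ld /xinj]; last exact: hinj.
  by have [[_ ?] ?] := hZ k kd; split=> //; exists (h k).
(* Bad colours are at most the default 0 and the colours of foreign chosen points in [A b]. *)
apply: (@sub_finite_set _ _ ([set 0] `|` (fun j => j.2.+1) @` Z)); last first.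
  by rewrite finite_setU; split; [exact: finite_set1|exact: finite_image].
case=> [_|n]; first by left.
apply: contra_notP => /not_orP[_ nZ]; apply/I_fE.
suff -> : A b `&` f @^-1` [set n.+1] = [set x (b, n)] by exact: card_set1.
apply/seteqP; split=> [t [At /= /fS[b' e]]|_ ->]; last first.
  by have [? _ _] := xP (b, n); split=> //=; rewrite fx.
rewrite -e; suff -> : b' = b by [].
apply: contrapT => b'b; apply: nZ; exists (b', n) => //; split=> //=.
by rewrite e.
Qed.

(** * Closures and families of more than kappa sets *)

Definition closure_step Lam T d (A : Lam -> set T) (U : set Lam) : set Lam :=
  U `|` [set i | `I_d.+1 #<= A i `&` \bigcup_(j in U) A j].

Definition sparse_closure Lam T d (A : Lam -> set T) (U : set Lam) : set Lam :=
  \bigcup_n iter n (closure_step d A) U.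

Lemma iter_closure_step_le Lam T d (A : Lam -> set T) (U : set Lam) m n :
  (m <= n)%N -> iter m (closure_step d A) U `<=` iter n (closure_step d A) U.
Proof.
move=> /subnK <-; elim: (n - m)%N => //= k IHk.
by apply: subset_trans IHk _; left.
Qed.

Lemma sub_closure Lam T d (A : Lam -> set T) (U : set Lam) : U `<=` sparse_closure d A U.
Proof. by move=> i Ui; exists 0. Qed.

Lemma sparse_closureS Lam T d (A : Lam -> set T) (U V : set Lam) :
  U `<=` V -> sparse_closure d A U `<=` sparse_closure d A V.
Proof.
move=> UV i [n _ Ui]; exists n => //; move: i Ui; elim: n => //= n IHn i.
move=> [/IHn|Ui]; [by left|right]; apply: card_le_trans Ui _.
by apply: subset_card_le; apply: setIS => t [j /IHn Vj Ajt]; exists j.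
Qed.

(** The stages increase, so [d + 1] points of their union already occur at one stage. Hence
    countably many steps suffice. *)
Lemma sparse_closure_closed Lam T d (A : Lam -> set T) (U : set Lam) i :
  `I_d.+1 #<= A i `&` \bigcup_(j in sparse_closure d A U) A j -> sparse_closure d A U i.
Proof.
move=> Ui.
have [||n _ Ani] := @card_II_bigcup _ _ setT
  (fun n => \bigcup_(j in iter n (closure_step d A) U) A j) (A i) d.
- move=> m n _ _; exists (maxn m n) => //.
  move=> t [[j Uj Ajt]|[j Uj Ajt]]; exists j => //.
    by apply: iter_closure_step_le Uj; exact: leq_maxl.
  by apply: iter_closure_step_le Uj; exact: leq_maxr.
- apply: card_le_trans Ui _; apply: subset_card_le; apply: setIS.
  by move=> t [j [n _ Uj] Ajt]; exists n => //; exists j.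
by exists n.+1 => //; right.
Qed.

Lemma small_closure Lam T d (A : Lam -> set T) (U : set Lam) TJ (J : set TJ) :
  infinite_set J -> sparse d A -> (forall i, small J (A i)) -> small J U ->
  small J (sparse_closure d A U).
Proof.
move=> Jinf Asp AJ UJ; apply: small_bigcup.
  by right; apply/infiniteP.
move=> n _; elim: n => //= n IHn; apply: small_setU => //.
by apply: sparse_few => //; exact: small_bigcup.
Qed.

(** The disjoint sum of [K] and the segment below [a] stands for max(kappa, |a|) without a case
    distinction. *)
Lemma cf_coloring_step Lam T K d (A : Lam -> set T) (lt : Lam -> Lam -> Prop) :
  infinite_set [set: K] -> sparse d A -> (forall i, A i #<= [set: K]) ->
  wellorder lt ->
  (forall a (S : set Lam),
    S #<= inl @` [set: K] `|` inr @` [set b | lt b a] ->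
    exists f : T -> nat, forall i, S i -> cofinite_set (I_f f (A i))) ->
  exists f : T -> nat, forall i, cofinite_set (I_f f (A i)).
Proof.
move=> Kinf Asp AK ltwo IH.
pose C a := sparse_closure d A [set b | b = a \/ lt b a].
have Csub b a : lt b a -> C b `<=` C a.
  move=> ba; apply: sparse_closureS => c [->|cb]; right => //.
  by have [_ tr _] := ltwo; exact: tr cb ba.
(* [rk i] is the stage at which [i] enters; it exists since [i] belongs to [C i]. *)
have /choice[rk rkP] : forall i, exists a, C a i /\ forall b, lt b a -> ~ C b i.
  move=> i; have Cii : C i i by apply: sub_closure; left.
  have [a Cai amin] := wellorder_min (P := [set a | C a i]) ltwo Cii.
  by exists a.
pose V a := \bigcup_(b in [set b | lt b a]) \bigcup_(i in C b) A i.
(* If [d + 1] points were shared, they would lie in the sets of a single earlier [C b], and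
   closedness would put [i] in [C b]. *)
have AVfin i : finite_set (A i `&` V (rk i)).
  have [_ rkmin] := rkP i.
  apply: (@not_card_II_finite _ _ d.+1) => /card_II_bigcup[|b brk].
    move=> b c ba ca; have [_ _ /(_ b c)[bc|->|cb]] := ltwo.
    - exists c => // t [[j /(Csub _ _ bc) Cj Ajt]|//]; by exists j.
    - by exists c => // t [].
    - exists b => // t [//|[j /(Csub _ _ cb) Cj Ajt]]; by exists j.
  by move=> Ab; apply: (rkmin b brk); exact: sparse_closure_closed Ab.
have /choice[g gP] : forall a, exists f : T -> nat,
    forall i, rk i = a -> cofinite_set (I_f f (A i)).
  move=> a; pose J : set (K + Lam) := inl @` [set: K] `|` inr @` [set b | lt b a].
  have KJ : [set: K] #<= J.
    apply: (@card_le_rel _ _ _ _ (fun k s => s = inl k)).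
      by move=> k _; exists (inl k) => //; left; exists k.
    by move=> k k' s _ _ -> [].
  have Jinf : infinite_set J.
    by apply/infiniteP; apply: card_le_trans KJ; exact/infiniteP.
  have CJ : C a #<= J.
    apply: small_infinite => //; apply: small_closure => //.
      by move=> i; right; apply: card_le_trans KJ.
    apply: (@small_le _ _ _ _ ([set a] `|` [set b | lt b a])).
      by apply: subset_card_le => b [->|]; [left|right].
    apply: small_setU; first by left; exact: finite_set1.
    right; apply: (@card_le_rel _ _ _ _ (fun b s => s = inr b)).
      by move=> b ba; exists (inr b) => //; right; exists b.
    by move=> b b' s _ _ -> [].
  have [f fP] := IH a _ CJ; exists f => i rki.
  by apply: fP; rewrite -rki; case: (rkP i).
(* [Q t a] says that block [a] is the first to cover [t]; the colouring [g a] then decides the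
   colour of [t]. *)
pose Q t a := (exists2 i, A i t & rk i = a) /\
  forall b, lt b a -> ~ exists2 i, A i t & rk i = b.
have /choice[f fP] : forall t, exists c, (exists i, A i t) ->
    exists2 a, Q t a & c = g a t.
  move=> t; have [[i Ait]|nA] := pselect (exists i, A i t); last by exists 0.
  have [a Pa amin] := wellorder_min (P := [set a | exists2 i, A i t & rk i = a])
    ltwo (ex_intro2 _ _ i Ait erefl).
  by exists (g a t) => _; exists a.
exists f => i; apply: cofinite_I_f_modify (AVfin i) _ (gP _ i erefl).
move=> t Ait nVt; have [|a [[j Ajt rkj] amin] ->] := fP t; first by exists i.
suff -> : a = rk i by [].
(* The first block covering [t] is not after [rk i], as [A i] covers [t], and not before, as [t] is
   outside [V (rk i)]. *)
have [_ _ /(_ a (rk i))[ai|//|ia]] := ltwo; last first.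
  by case: (amin _ ia); exists i.
case: nVt; split=> //; exists a => //; exists j => //.
by rewrite -rkj; case: (rkP j).
Qed.

Lemma cf_coloring Lam T K d (A : Lam -> set T) :
  infinite_set [set: K] -> sparse d A -> (forall i, A i #= [set: K]) ->
  exists f : T -> nat, forall i, cofinite_set (I_f f (A i)).
Proof.
move=> Kinf Asp AK.
have AKle i : A i #<= [set: K] by rewrite (card_le_eql (AK i)); exact: card_lexx.
have KAle i : [set: K] #<= A i by rewrite (card_le_eqr (AK i)); exact: card_lexx.
have sub_sp (S : set Lam) : sparse d (fun i : S => A (val i)).
  by move=> i j ij; apply: Asp => /val_inj.
have colK (S : set Lam) : S #<= [set: K] ->
    exists f : T -> nat, forall i, S i -> cofinite_set (I_f f (A i)).
  move=> SK; have [||||f fP] := @cf_coloring_base S T K d (fun i => A (val i)).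
  - exact: Kinf.
  - by rewrite (card_le_eql (card_setT S)).
  - exact: sub_sp.
  - by move=> i; exact: KAle.
  by exists f => i /mem_set Si; exact: (fP (SigSub Si)).
have [lt ltwo] := wellorder_exists Lam.
(* The larger summand decides: either the segment below [a] bounds [S], or [K] does and the base
   case applies. [B] is kept general because the induction below uses pulled-back segments. *)
have col_sum a (U : Type) (B : set U) (S : set Lam) :
    B #<= [set b | lt b a] ->
    (forall S' : set Lam, S' #<= [set b | lt b a] ->
      exists f : T -> nat, forall i, S' i -> cofinite_set (I_f f (A i))) ->
    S #<= (inl @` [set: K] : set (K + U)) `|` inr @` B ->
    exists f : T -> nat, forall i, S i -> cofinite_set (I_f f (A i)).
  move=> Ba col_a SKB.
  have SJ TJ (J : set TJ) : infinite_set J -> [set: K] #<= J ->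
      [set b | lt b a] #<= J -> S #<= J.
    move=> Jinf KJ aJ; apply: small_infinite => //; apply: small_le SKB _.
    apply: small_setU; right.
      exact: card_le_trans (card_image_le _ _) KJ.
    exact: card_le_trans (card_image_le _ _) (card_le_trans Ba aJ).
  have [Ka|aK] := card_le_total [set: K] [set b | lt b a].
    apply: col_a; apply: (SJ _ _ _ Ka (card_lexx _)).
    by move=> /(card_le_finite Ka).
  exact: colK _ (SJ _ _ Kinf (card_lexx _) aK).
(* Induction on [a]: [S] is ordered through an injection [h] into the segment below [a], so its
   segments embed below some [h b], which precedes [a]. *)
have init_col a (S : set Lam) : S #<= [set b | lt b a] ->
    exists f : T -> nat, forall i, S i -> cofinite_set (I_f f (A i)).
  case: (ltwo) => wf _ _; elim/(well_founded_ind wf): a S => a IH S.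
  move=> /card_leE[h hinj ha].
  have [|||||f fP] := @cf_coloring_step S T K d (fun i => A (val i))
    (fun i j => lt (h i) (h j)).
  - exact: Kinf.
  - exact: sub_sp.
  - by move=> i; exact: AKle.
  - exact: wellorder_pullback.
  - move=> b S' S'b.
    have [|||f fP] := @col_sum (h b) S [set c | lt (h c) (h b)] (val @` S').
    + exact: card_init_pullback.
    + by apply: IH; exact: ha.
    + exact: card_le_trans (card_image_le _ _) S'b.
    by exists f => i S'i; apply: fP; exists i.
  by exists f => i /mem_set Si; exact: (fP (SigSub Si)).
apply: (cf_coloring_step Kinf Asp AKle ltwo) => a S Sa.
by apply: (col_sum a) Sa; [exact: card_lexx|exact: init_col].
Qed.

Theorem theorem4p1 (L K : Type) (d : nat) :
  [set: nat] #<= [set: K] -> [set: K] #<= [set: L] ->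
  (forall (T : Type) (Fam : set (set T)), system L K d Fam ->
     cf_colorable_omega Fam) /\
  arrow_omega L K d.
Proof.
move=> /infiniteP Kinf _.
have arrow : arrow_omega L K d.
  move=> T Fam [_ FamK Famd].
  have [|i|f fP] := @cf_coloring Fam T K d val Kinf.
  - move=> A B AB.
    have [|n [nd nAB]] := Famd _ _ (set_valP A) (set_valP B).
      by move=> /val_inj.
    by rewrite (card_le_eqr nAB) card_le_II leqNgt ltnS ltnW.
  - exact/FamK/set_valP.
  by exists f => A /mem_set FA; exact: (fP (SigSub FA)).
(* A cofinite set of natural numbers is nonempty, so the arrow relation gives conflict-freeness. *)
split=> // T Fam /arrow[f fP]; exists f => A /fP fA.
by apply: infinite_setN0; exact: cofinite_set_infinite infinite_nat fA.
Qed.
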